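(* Let $(X,d_X,\odot,0_X)$ be an editable space and let $T$ and $T'$ be two $X$-valued dendrograms. For every finite edit path $\gamma$ from $T$ to $T'$ there is a mapping $M\in \mathrm{Mapp}(T,T')$ such that $cost(M)\leq cost(\gamma)$.
   Context: **Editable spaces.** An editable space is a set $X$ with a metric $d_X$, an operation $\odot$ and an element $0_X$ such that: (P1) $(X,d_X)$ is a metric space; (P2) $(X,\odot,0_X)$ is a commutative monoid; (P3) $d_X(0_X,x\odot y)=d_X(0_X,x)+d_X(0_X,y)$ for all $x,y$; (P4) $d_X(x,y)=d_X(z\odot x,z\odot y)=d_X(x\odot z,y\odot z)$ for all $x,y,z$. **Dendrograms.** A tree structure $T$ is a finite connected rooted acyclic graph $(V_T,E_T)$ with root $r_T$. The relation child $<$ parent generates a partial order on $V_T$. Each edge is written $(a,b)$ with $a<b$ ($b$ the parent of $a$) and is identified with its lower vertex $a$, so $E_T\cong V_T\setminus\{r_T\}$. Leaves are vertices with no children. A ''degree $2$ vertex'' is a non-root vertex with exactly one child. An ($X$-valued) dendrogram is a tree structure $T$ with a weight function $\varphi_T:E_T\to X\setminus\{0_X\}$. Dendrograms are considered up to isomorphism of rooted trees preserving weights. **Edits and costs.** - Shrinking an edge: replace its weight $x$ by another element $y\in X\setminus\{0_X\}$; cost $d_X(x,y)$. - Deleting an edge $(v_1,v_2)$ of weight $x$: remove $v_1$, its children becoming children of $v_2$ (keeping their weights); cost $d_X(x,0_X)$. Its inverse is the insertion of an edge of weight $x\in X\setminus\{0_X\}$ at a vertex $v$ (a new child of $v$ is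 created and any, possibly empty, subset of the children of $v$ becomes the set of its children); cost $d_X(x,0_X)$. - Ghosting a degree $2$ vertex $v$: remove $v$ and join its two adjacent edges, of weights $x,y$, into one edge of weight $x\odot y$; cost $0$. Its inverse is the splitting of an edge (of weight $x\odot y$ into two consecutive edges of weights $x,y\in X\setminus\{0_X\}$); cost $0$. A finite edit path from $T$ to $T'$ is a finite composition of edits transforming $T$ into (a dendrogram isomorphic to) $T'$; its cost is the sum of the costs of its edits. **Mappings.** Let $\mathfrak D,\mathfrak G$ be two symbols (''deletion'', ''ghosting''). A mapping between $T$ and $T'$ is a set $M\subset (E_T\cup\{\mathfrak D,\mathfrak G\})\times(E_{T'}\cup\{\mathfrak D,\mathfrak G\})$, containing no pair in $\{\mathfrak D,\mathfrak G\}\times\{\mathfrak D,\mathfrak G\}$, such that: (M1)-(M2) every element of $E_T$ is the first component of exactly one pair of $M$, and every element of $E_{T'}$ is the second component of exactly one pair of $M$; (M3) for $(a,b),(c,d)\in M\cap(V_T\times V_{T'})$: $a>c$ if and only if $b>d$; (M4) if $(a,\mathfrak G)\in M$ then, after applying all deletions of the $v$ with $(v,\mathfrak D)\in M$, the vertex $a$ is a degree $2$ vertex; analogously in $T'$ for $(\mathfrak G,a)\in M$. $\mathrm{Mapp}(T,T')$ is the set of all mappings. **Cost of a mapping.** Given $M$, delete from $T$ all $v$ with $(v,\mathfrak D)\in M$ and then ghost all $v$ with $(v,\mathfrak G)\in M$, obtaining $T_M$; similarly delete from $T'$ all $w$ with $(\mathfrak D,w)\in M$ and then ghost all $w$ with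 $(\mathfrak G,w)\in M$, obtaining $T'_M$. The remaining pairs $(v,w)\in M\cap(E_T\times E_{T'})$ give an isomorphism of tree structures $T_M\cong T'_M$, and each edge $v$ of $T_M$ is shrunk to the weight of $w$ in $T'_M$. Then $$cost(M)=\sum_{(v,\mathfrak D)\in M}d_X(\varphi_T(v),0_X)+\sum_{(\mathfrak D,w)\in M}d_X(\varphi_{T'}(w),0_X)+\sum_{(v,w)\in M\cap(E_T\times E_{T'})}d_X(\varphi_{T_M}(v),\varphi_{T'_M}(w)).$$ *)

(* Defs.v *)
From HB Require Import structures.
From mathcomp Require Import all_boot all_order all_algebra.
From mathcomp Require Import all_classical all_reals topology.
Set Implicit Arguments.
Unset Strict Implicit.
Unset Printing Implicit Defensive.
Import Order.TTheory GRing.Theory Num.Theory.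
Local Open Scope ring_scope.

(* The monoid operation is written additively: x + y stands for x \odot y and
   0 for 0_X.  The topology that comes with metricType is the one induced by
   the distance mdist and plays no role. *)
HB.mixin Record isEditableSpace (R : realType) X & Metric R X & GRing.Nmodule X := {
  mdist0D : forall x y : X, mdist (0 : X) (x + y) = mdist (0 : X) x + mdist (0 : X) y :> R;
  mdistDl : forall x y z : X, mdist x y = mdist (z + x : X) (z + y : X) :> R;
  mdistDr : forall x y z : X, mdist x y = mdist (x + z : X) (y + z : X) :> R
}.

#[short(type="editableSpaceType")]
HB.structure Definition EditableSpace (R : realType) :=
  {X of Metric R X & GRing.Nmodule X & isEditableSpace R X}.

Section WeightedTrees.
Context {R : realType} {X : editableSpaceType R}.

(* Raw data of a rooted weighted tree whose vertices form a subset of V.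
   The edges are the pairs (a, parent a) for a vertex a other than the root,
   identified with a; parent and weight are meaningless outside the edges.
   Keeping V fixed while verts shrinks lets edits be iterated on one type. *)
Record wtree (V : finType) := WTree {
  verts : {set V};
  treeroot : V;
  parent : V -> V;
  weight : V -> X
}.

Section OneTree.
Context {V : finType}.
Implicit Types (T : wtree V) (a b c v x y : V).

Definition edges T : {set V} := verts T :\ treeroot T.

Definition child T : rel V := [rel a b | (a \in edges T) && (parent T a == b)].

Definition adj T : rel V := [rel a b | child T a b || child T b a].

Definition children T v : {set V} := [set a | child T a v].

Definition degree2 T v : bool := (v \in edges T) && (#|children T v| == 1)%N.

(* The strict partial order generated by child < parent. *)
Definition below T : rel V := [rel a b | (a != b) && connect (child T) a b].

(* Cycles of length 2 in adj go back and forth along one edge, so a genuine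
   cycle has length at least 3; loops are excluded separately. *)
Record is_dendrogram T : Prop := IsDendrogram {
  root_verts : treeroot T \in verts T;
  parent_verts : forall v, v \in edges T -> parent T v \in verts T;
  adj_loopless : forall v, ~~ adj T v v;
  adj_connected : {in verts T &, forall x y, connect (adj T) x y};
  adj_acyclic : forall s : seq V, ucycle (adj T) s -> (size s <= 2)%N;
  weight_neq0 : forall v, v \in edges T -> weight T v != 0
}.

Definition shrink T v (y : X) : wtree V :=
  WTree (verts T) (treeroot T) (parent T)
    (fun x => if x == v then y else weight T x).

Definition delete T v : wtree V :=
  WTree (verts T :\ v) (treeroot T)
    (fun x => if child T x v then parent T v else parent T x)
    (weight T).

(* For v of degree 2 the merged edge keeps the lower vertex of the two. *)
Definition ghost T v : wtree V :=
  WTree (verts T :\ v) (treeroot T)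
    (fun x => if child T x v then parent T v else parent T x)
    (fun x => if child T x v then weight T x + weight T v else weight T x).

Definition delete_all T (A : {set V}) : wtree V := foldl delete T (enum A).

Definition ghost_all T (A : {set V}) : wtree V := foldl ghost T (enum A).

End OneTree.

Definition isomorphic (V V' : finType) (T : wtree V) (T' : wtree V') : Prop :=
  exists f : V -> V',
    [/\ {in verts T &, injective f},
        f @: verts T = verts T',
        f (treeroot T) = treeroot T',
        {in edges T, forall v, f (parent T v) = parent T' (f v)} &
        {in edges T, forall v, weight T' (f v) = weight T v}].

End WeightedTrees.

Arguments wtree {R} X V.

Record dendrogram (R : realType) (X : editableSpaceType R) := Dendrogram {
  vtype : finType;
  dtree :> wtree X vtype;
  dendrogramP : is_dendrogram dtree
}.

Section EditPaths.
Context {R : realType} {X : editableSpaceType R}.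
Implicit Types T : dendrogram X.

(* A single edit from T to T', up to isomorphism.  Insertions and splittings
   are the inverses of deletions and ghostings, hence the vertex v that they
   create belongs to T'. *)
Inductive edit T T' : Type :=
| Shrink (v : vtype T) (y : X) of
    v \in edges T & y != 0 & isomorphic (shrink T v y) T'
| Delete (v : vtype T) of
    v \in edges T & isomorphic (delete T v) T'
| Insert (v : vtype T') of
    v \in edges T' & isomorphic (delete T' v) T
| Ghost (v : vtype T) of
    degree2 T v & isomorphic (ghost T v) T'
| Split (v : vtype T') of
    degree2 T' v & isomorphic (ghost T' v) T.

Definition edit_cost T T' (e : edit T T') : R :=
  match e with
  | Shrink v y _ _ _ => mdist (weight T v) y
  | Delete v _ _ => mdist (weight T v) 0
  | Insert v _ _ => mdist (weight T' v) 0
  | Ghost _ _ _ => 0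
  | Split _ _ _ => 0
  end.

Inductive edit_path : dendrogram X -> dendrogram X -> Type :=
| PathNil T T' of isomorphic T T' : edit_path T T'
| PathCons T T1 T' of edit T T1 & edit_path T1 T' : edit_path T T'.

Fixpoint path_cost T T' (gamma : edit_path T T') : R :=
  match gamma with
  | PathNil _ _ _ => 0
  | PathCons _ _ _ e gamma' => edit_cost e + path_cost gamma'
  end.

End EditPaths.

Inductive symbol := Deletion | Ghosting.

Definition bool_of_symbol (s : symbol) : bool :=
  if s is Deletion then true else false.
Definition symbol_of_bool (b : bool) : symbol :=
  if b then Deletion else Ghosting.
Lemma bool_of_symbolK : cancel bool_of_symbol symbol_of_bool.
Proof. by case. Qed.
HB.instance Definition _ := Equality.copy symbol (can_type bool_of_symbolK).
HB.instance Definition _ := Choice.copy symbol (can_type bool_of_symbolK).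
HB.instance Definition _ := Countable.copy symbol (can_type bool_of_symbolK).
HB.instance Definition _ : isFinite symbol := CanIsFinite bool_of_symbolK.

(* inl v is the edge with lower vertex v, inr s is one of the two symbols. *)
Definition pairing (V V' : finType) := {set (V + symbol) * (V' + symbol)}.

Section Mappings.
Context {R : realType} {X : editableSpaceType R} {V V' : finType}.
Implicit Types M : pairing V V'.

Definition deletedl M : {set V} := [set v | (inl v, inr Deletion) \in M].
Definition deletedr M : {set V'} := [set w | (inr Deletion, inl w) \in M].
Definition ghostedl M : {set V} := [set v | (inl v, inr Ghosting) \in M].
Definition ghostedr M : {set V'} := [set w | (inr Ghosting, inl w) \in M].

Definition edge_or_symbol (W : finType) (S : wtree X W) (p : W + symbol) :=
  if p is inl v then v \in edges S else true.

Record is_mapping (T : wtree X V) (T' : wtree X V') M : Prop := IsMapping {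
  mapping_support : forall p, p \in M ->
    edge_or_symbol T p.1 && edge_or_symbol T' p.2;
  mapping_no_symbols : forall s s', (inr s, inr s') \notin M;
  mapping_uniql : forall v, v \in edges T ->
    exists! p, p \in M /\ p.1 = inl v;
  mapping_uniqr : forall w, w \in edges T' ->
    exists! p, p \in M /\ p.2 = inl w;
  mapping_order : forall a b c d,
    (inl a, inl b) \in M -> (inl c, inl d) \in M ->
    (below T c a <-> below T' d b);
  mapping_ghostl : forall a, (inl a, inr Ghosting) \in M ->
    degree2 (delete_all T (deletedl M)) a;
  mapping_ghostr : forall b, (inr Ghosting, inl b) \in M ->
    degree2 (delete_all T' (deletedr M)) b
}.

(* The trees T_M and T'_M: first the deletions, then the ghostings.  When M is
   a mapping the result does not depend on the order inside each batch. *)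
Definition reducedl (T : wtree X V) M : wtree X V :=
  ghost_all (delete_all T (deletedl M)) (ghostedl M).
Definition reducedr (T' : wtree X V') M : wtree X V' :=
  ghost_all (delete_all T' (deletedr M)) (ghostedr M).

Definition mapping_cost (T : wtree X V) (T' : wtree X V') M : R :=
  \sum_(v in deletedl M) mdist (weight T v) 0 +
  \sum_(w in deletedr M) mdist (weight T' w) 0 +
  \sum_(vw : V * V' | (inl vw.1, inl vw.2) \in M)
     mdist (weight (reducedl T M) vw.1) (weight (reducedr T' M) vw.2).

End Mappings.

(* Main.v *)
Require Import Defs.
From mathcomp Require Import all_boot all_order all_algebra.
From mathcomp Require Import all_classical all_reals topology.
Set Implicit Arguments.
Unset Strict Implicit.
Unset Printing Implicit Defensive.
Import Order.TTheory GRing.Theory Num.Theory.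
Local Open Scope ring_scope.

(** The idea is to replace mappings by a looser notion that follows an edit
    path one edit at a time, and to turn it into a mapping only at the end.

    An alignment of two trees T and S labels the edges of both by the elements
    of a finite set L, and costs the sum over the labels l of the distance
    between the total weight of the edges of T labelled l and the total weight
    of the edges of S labelled l.  A label used on both sides stands for a
    chain of edges of T that is matched with a chain of edges of S: its edges
    must be pairwise comparable, and two distinct such labels must be in the
    same relative position in T and in S.  A label used on one side only stands
    for deleted edges.  Since the distance to 0 is additive, its contribution
    to the cost is the sum of the costs of these deletions, however the deleted
    edges are grouped, so nothing is required of the edges of such a label.

    An edit at the beginning of the path is absorbed by the alignment that its
    tail provides.  Shrinking changes no label.  A deleted edge receives a label
    of its own.  Undoing an insertion forgets the label of the inserted edge,
    whose label may then become one-sided, which is harmless.  If v is ghosted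
    and c is its only child, v takes the label of c.  The remaining edit, undoing
    the splitting that created v above its only child c, is the delicate one
    (alignable_split): the joined edge has to carry a single label, whereas v
    and c may carry two.  When both labels are used on the two sides, they are
    merged everywhere, which is legitimate because nothing lies between v and c
    (alignment_merge); when one of them is one-sided, the edge carrying it
    moves to the other label.  The triangle inequality and the translation
    invariance of the distance show that none of this costs more than the edit.

    An alignment becomes a mapping (mapping_of_labelsP) by deleting the edges
    whose label is one-sided, coupling the lowest edges of T and S with a common
    label, and ghosting all other edges.  The point is that, once the deletions
    are done, an edge g that is not the lowest one of its label has exactly one
    child, and this child has the same label as g (stacked_only_child).  Hence g
    has degree 2, ghosting g leaves the total weight of each label unchanged
    (foldl_ghost), and the coupled edges end up with the total weights of their
    labels: the cost of the mapping is the cost of the alignment. *)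

(** * Distances in an editable space *)

Section EditableSpaceTheory.
Context {R : realType} {X : editableSpaceType R}.
Implicit Types x y z t : X.

Lemma mdist0_sum (I : Type) (r : seq I) (P : pred I) (F : I -> X) :
  mdist 0 (\sum_(i <- r | P i) F i) = \sum_(i <- r | P i) mdist 0 (F i).
Proof.
by apply: (big_morph (fun x => mdist (0 : X) x) (@mdist0D R X)); rewrite mdistxx.
Qed.

Lemma mdistDD x y z t : mdist (x + z) (y + t) <= mdist x y + mdist z t.
Proof.
by rewrite (mdistDr x y z) (mdistDl z t y); exact: metric_triangle.
Qed.

Lemma mdist_sum (I : Type) (r : seq I) (P : pred I) (F G : I -> X) :
  mdist (\sum_(i <- r | P i) F i) (\sum_(i <- r | P i) G i) <=
  \sum_(i <- r | P i) mdist (F i) (G i).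
Proof.
elim/big_rec3: _ => [|i a b c _ IH]; first by rewrite mdistxx.
by apply: le_trans (mdistDD _ _ _ _) _; rewrite lerD2l.
Qed.

End EditableSpaceTheory.

(** * The order of a rooted tree, and how edits change it *)

Section Order.
Context {R : realType} {X : editableSpaceType R} {V : finType}.
Implicit Types (T : wtree X V) (a b c u v x y : V).

(** The reflexive version of the order of the tree, which reads more easily
    than the strict one in statements about chains. *)
Definition le_tree T : rel V := connect (child T).

(** A directed form of connectedness and acyclicity, which is visibly stable
    under deletion and ghosting.  It makes the order antisymmetric because each
    vertex has a single parent (child_irr_le). *)
Definition rooted T : Prop :=
  treeroot T \in verts T /\ {in verts T, forall v, le_tree T v (treeroot T)}.

Lemma childP T a b :
  reflect (a \in edges T /\ parent T a = b) (child T a b).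
Proof. by apply: (iffP andP) => -[aT /eqP]. Qed.

Lemma edges_verts T a : a \in edges T -> a \in verts T.
Proof. by case/setD1P. Qed.

Lemma childN_root T b : child T (treeroot T) b = false.
Proof. by apply/negbTE; apply/andP=> -[/setD1P[/eqP]]. Qed.

Lemma le_tree_refl T a : le_tree T a a.
Proof. exact: connect0. Qed.

Lemma le_tree_trans T b a c : le_tree T a b -> le_tree T b c -> le_tree T a c.
Proof. exact: connect_trans. Qed.

Lemma child_le T a b : child T a b -> le_tree T a b.
Proof. exact: connect1. Qed.

Lemma le_tree_case T a b : le_tree T a b ->
  a = b \/ [/\ a \in edges T & le_tree T (parent T a) b].
Proof.
move=> /connectP[[|y p] /= pth ->]; first by left.
move: pth => /andP[/childP[aT <-] pth]; right; split=> //.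
by apply/connectP; exists p.
Qed.

Lemma le_tree_caser T a b : le_tree T a b ->
  a = b \/ exists2 c, child T c b & le_tree T a c.
Proof.
move=> /connectP[p]; case/lastP: p => [|p y] pth ->; first by left.
rewrite last_rcons; move: pth; rewrite rcons_path => /andP[pth cy].
by right; exists (last a p) => //; apply/connectP; exists p.
Qed.

(** The vertices from which the root can be reached by going up form a set that
    is closed under adjacency; it contains the root, so by connectedness it
    contains every vertex. *)
Lemma dendrogram_rooted T : is_dendrogram T -> rooted T.
Proof.
case=> rT pT _ conT _ _; split=> // v vT.
have /connectP[p pth ->] := conT _ _ rT vT.
(* A path of adj from the root to v is followed forwards, carrying along the
   fact that its current vertex reaches the root by going up. *)
suff H : forall x, x \in verts T -> le_tree T x (treeroot T) ->
    path (adj T) x p -> le_tree T (last x p) (treeroot T).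
  exact: H rT (le_tree_refl _ _) pth.
elim: p {v vT pth} => [//|y p IH] x xT xr /= /andP[/orP[xy|yx] pth].
- case/childP: (xy) => xe xye; apply: (IH y) => //.
    by rewrite -xye pT.
  case/le_tree_case: xr => [xr|[_]]; last by rewrite xye.
  by move: xy; rewrite xr childN_root.
- case/childP: (yx) => ye _; apply: (IH y) => //; first exact: edges_verts.
  exact: le_tree_trans (child_le yx) xr.
Qed.

Lemma le_tree_verts T a b : rooted T -> a \in verts T -> le_tree T a b -> b \in verts T.
Proof.
move=> [rT upT] aT /connectP[p pth ->].
elim: p a aT pth => [//|y p IH] a aT /= /andP[/childP[ae <-] pth].
apply: IH pth; case/le_tree_case: (upT a aT) => [ar|[_]].
  by move: ae; rewrite ar setD11.
by case/le_tree_case => [->|[/edges_verts]].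
Qed.

(** A directed cycle is a trap, as each vertex has one parent only: a walk up
    from one of its vertices would never leave it, but it has to reach the
    root, which has no parent. *)
Lemma child_irr_le T a b : rooted T -> child T a b -> ~~ le_tree T b a.
Proof.
move=> rT ab; apply/negP => ba; case/childP: (ab) => ae _.
have /connectP[p pth /esym lst] := rT.2 _ (edges_verts ae).
elim: p a b ab ba {ae} pth lst => [|z p IH] a b ab ba /=.
  by move=> _ ar; move: ab; rewrite ar childN_root.
move=> /andP[az pth] lst.
have zb : z = b by case/childP: ab => _ <-; case/childP: az => _ <-.
rewrite {z}zb in az pth lst.
case/le_tree_case: (ba) => [bE|[be ba']].
  by apply: (IH b b) pth lst; [rewrite -{1}bE in ab | exact: le_tree_refl].
apply: (IH b (parent T b)) pth lst; first by apply/childP.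
exact: le_tree_trans ba' (child_le ab).
Qed.

Lemma le_tree_anti T a b : rooted T -> le_tree T a b -> le_tree T b a -> a = b.
Proof.
move=> rT /le_tree_case[//|[ae ab] ba].
have cab : child T a (parent T a) by apply/childP.
by have := child_irr_le rT cab; rewrite (le_tree_trans ab ba).
Qed.

Lemma child_neq T a b : rooted T -> child T a b -> a != b.
Proof.
by move=> rT ab; apply/eqP => E; have := child_irr_le rT ab; rewrite E le_tree_refl.
Qed.

Lemma belowE T a b : below T a b = (a != b) && le_tree T a b.
Proof. by []. Qed.

Lemma edges_delete T v : edges (delete T v) = edges T :\ v.
Proof. by apply/setP=> x; rewrite !inE andbCA. Qed.

Lemma parent_delete T v x :
  parent (delete T v) x = if child T x v then parent T v else parent T x.
Proof. by []. Qed.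

(** An ascending path of T that goes through v becomes a path that jumps from a
    child of v to the parent of v. *)
Lemma le_delete T v a b : rooted T -> v \in edges T -> a != v -> b != v ->
  le_tree (delete T v) a b = le_tree T a b.
Proof.
move=> rT ve av bv; apply/idP/idP.
  apply: connect_sub => {av bv} x y /childP[]; rewrite edges_delete !inE /=.
  move=> /and3P[xv xr xT]; have xe : x \in edges T by rewrite !inE xr.
  case: ifP => [xv' <-|_ <-]; last by apply: child_le; apply/childP.
  apply: (le_tree_trans (child_le xv')); apply: child_le; exact/childP.
move=> /connectP[p pth lst].
(* Generalized to a = v, so that an induction along the path can step on v:
   there the path in delete T v is already at the parent of v. *)
suff : le_tree (delete T v) (if a == v then parent T v else a) b.
  by rewrite (negPf av).
elim: p a pth lst {av} => [|x p IH] a /=.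
  by move=> _ <-; rewrite (negPf bv) le_tree_refl.
move=> /andP[ax pth] lst; have {IH} := IH x pth lst.
case/childP: (ax) => ae xE.
have [av|av] := eqVneq a v.
  have -> : (x == v) = false.
    by apply/negbTE; rewrite eq_sym -av; exact: (child_neq rT ax).
  by rewrite -xE av.
have aD : a \in edges (delete T v) by rewrite edges_delete in_setD1 av.
have [xv|xv] := eqVneq x v => le_b; apply: le_tree_trans le_b; apply: child_le.
  by apply/childP; split; rewrite // parent_delete -xv ax.
apply/childP; split; rewrite // parent_delete; case: ifP => // /childP[_].
by rewrite xE => /eqP; rewrite (negPf xv).
Qed.

Lemma rooted_delete T v : rooted T -> v \in edges T -> rooted (delete T v).
Proof.
move=> rT ve; have rv : treeroot T != v.
  by apply/eqP => E; move: ve; rewrite -E !inE eqxx.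
split; first by rewrite !inE rv rT.1.
move=> x /setD1P[xv xT]; rewrite le_delete //; exact: rT.2.
Qed.

Lemma edges_ghost T v : edges (ghost T v) = edges T :\ v.
Proof. exact: edges_delete. Qed.

Lemma le_ghost T v : le_tree (ghost T v) = le_tree (delete T v).
Proof. by []. Qed.

Lemma rooted_ghost T v : rooted T -> v \in edges T -> rooted (ghost T v).
Proof. exact: rooted_delete. Qed.

Lemma degree2P T v :
  reflect (v \in edges T /\ exists c, children T v = [set c]) (degree2 T v).
Proof. by apply: (iffP andP) => -[ve /cards1P]. Qed.

Lemma only_childP T v c : children T v = [set c] -> forall x, child T x v = (x == c).
Proof. by move=> /setP cE x; have := cE x; rewrite !inE. Qed.

(** No vertex lies between v and its only child c, so v and c are
    interchangeable in comparisons with the other vertices: this is what allows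
    them to share a label. *)
Lemma le_only_child_down T v c a : children T v = [set c] -> a != v ->
  le_tree T a v = le_tree T a c.
Proof.
move=> cE av; have cv : child T c v by rewrite (only_childP cE).
apply/idP/idP => [/le_tree_caser[/eqP|[x]]|ac]; first by rewrite (negPf av).
  by rewrite (only_childP cE) => /eqP ->.
exact: le_tree_trans ac (child_le cv).
Qed.

Lemma le_only_child_up T v c a : children T v = [set c] -> a != c ->
  le_tree T v a = le_tree T c a.
Proof.
move=> cE ac; have cv : child T c v by rewrite (only_childP cE).
apply/idP/idP => [|/le_tree_case[/eqP|[_]]]; first exact: le_tree_trans (child_le cv).
  by rewrite eq_sym (negPf ac).
by case/childP: cv => _ ->.
Qed.

Definition fibre_weight (L : finType) T (s : V -> L) (l : L) : X :=
  \sum_(e in edges T | s e == l) weight T e.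

(** The weight of v moves to c, which carries the same label. *)
Lemma fibre_weight_ghost (L : finType) T (s : V -> L) v c l :
  rooted T -> v \in edges T ->
  children T v = [set c] -> s v = s c ->
  fibre_weight (ghost T v) s l = fibre_weight T s l.
Proof.
move=> rT ve cE svc; have cv : child T c v by rewrite (only_childP cE).
have [ce _] := childP _ _ _ cv; have cNv := child_neq rT cv.
rewrite /fibre_weight edges_ghost /=.
rewrite [RHS]big_mkcondr (big_setD1 v) //= svc -big_mkcondr /=.
rewrite (eq_bigr (fun e => weight T e + (if e == c then weight T v else 0))); last first.
  move=> e _; move: (only_childP cE e) => /= ->.
  by case: ifP; rewrite ?addr0.
rewrite big_split /= addrC; congr (_ + _).
rewrite -big_mkcondr /=; case: ifP => scl; last first.
  rewrite big1 // => e /andP[/andP[_ /eqP sel] /eqP ec].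
  by rewrite -ec sel eqxx in scl.
rewrite (big_pred1 c) // => e; rewrite in_setD1 /=.
by have [->|_] := eqVneq e c; rewrite ?andbF // cNv ce scl.
Qed.

End Order.

(** * Isomorphisms *)

Section Isomorphism.
Context {R : realType} {X : editableSpaceType R} {V W : finType}.
Implicit Types (T : wtree X V) (S : wtree X W).

Lemma isomorphic_sym T S : rooted T -> isomorphic T S -> isomorphic S T.
Proof.
move=> rT [f [fI fV fr fp fw]].
(* The inverse of f on the vertices of S, with the root as junk value. *)
pose g y := odflt (treeroot T) [pick x in verts T | f x == y].
have gK : {in verts T, forall x, g (f x) = x}.
  move=> x xT; rewrite /g; case: pickP => [z /andP[zT /eqP /(fI _ _ zT xT)]//|].
  by move/(_ x); rewrite xT eqxx.
have fE x : x \in verts T -> (f x \in edges S) = (x \in edges T).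
  move=> xT; rewrite !in_setD1 -fV imset_f // xT !andbT -fr (inj_in_eq fI) //.
  exact: rT.1.
exists g; split.
- move=> y z; rewrite -!fV => /imsetP[a aT ->] /imsetP[b bT ->].
  by rewrite !gK // => ->.
- apply/setP=> x; apply/imsetP/idP => [[y]|xT].
    by rewrite -fV => /imsetP[z zT ->] ->; rewrite gK.
  by exists (f x); rewrite ?gK // -fV imset_f.
- by rewrite -fr gK // rT.1.
- move=> y ye; have := edges_verts ye; rewrite -fV => /imsetP[x xT yE].
  move: ye; rewrite yE fE // => xe; rewrite -fp // !gK //.
  exact: (le_tree_verts rT xT (child_le (introT (childP T x _) (conj xe erefl)))).
- move=> y ye; have := edges_verts ye; rewrite -fV => /imsetP[x xT yE].
  by move: ye; rewrite yE fE // => xe; rewrite gK // fw.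
Qed.

Lemma iso_edges (f : V -> W) T S : rooted T ->
  {in verts T &, injective f} -> f @: verts T = verts S ->
  f (treeroot T) = treeroot S -> edges S = f @: edges T.
Proof.
move=> rT fI fV fr; apply/setP=> y; rewrite in_setD1 -fV -fr.
apply/andP/imsetP => [[yr /imsetP[x xT yE]]|[x xe ->]].
  by exists x => //; rewrite !inE xT andbT; apply: contraNneq yr => <-; rewrite yE.
have xT := edges_verts xe; rewrite imset_f // (inj_in_eq fI) //; last exact: rT.1.
by case/setD1P: xe.
Qed.

Lemma iso_le (f : V -> W) T S : rooted T ->
  {in verts T &, injective f} -> f @: verts T = verts S ->
  f (treeroot T) = treeroot S ->
  {in edges T, forall v, f (parent T v) = parent S (f v)} ->
  {in edges T &, forall a b, le_tree S (f a) (f b) = le_tree T a b}.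
Proof.
move=> rT fI fV fr fp a b ae be; have eS := iso_edges rT fI fV fr.
have pT x : x \in edges T -> parent T x \in verts T.
  move=> xe; apply: le_tree_verts rT (edges_verts xe) (child_le _).
  exact/childP.
have {}be := edges_verts be.
apply/idP/idP => /connectP[p]; move: (edges_verts ae) => {ae}.
  elim: p a => [|y p IH] a aT /=; first by move=> _ /(fI _ _ be aT) ->; exact: le_tree_refl.
  move=> /andP[/childP[ae' <-] pth] lst.
  have ae : a \in edges T.
    move: ae'; rewrite eS => /imsetP[a' a'e /(fI _ _ aT (edges_verts a'e))].
    by move=> ->.
  rewrite -fp // in pth lst.
  apply: le_tree_trans (IH _ (pT _ ae) pth lst); apply: child_le; exact/childP.
elim: p a => [|y p IH] a aT /=; first by move=> _ ->; exact: le_tree_refl.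
move=> /andP[/childP[ae <-] pth] lst.
apply: le_tree_trans (IH _ (pT _ ae) pth lst); rewrite fp //; apply: child_le.
by apply/childP; split=> //; rewrite eS imset_f.
Qed.

End Isomorphism.

(** * Labellings and alignments *)

Section FibreWeights.
Context {R : realType} {X : editableSpaceType R} {V : finType}.
Implicit Types (T : wtree X V).

Lemma eq_in_fibre_weight (L : finType) T (s r : V -> L) l :
  {in edges T, s =1 r} -> fibre_weight T s l = fibre_weight T r l.
Proof.
by move=> E; apply: eq_bigl => e; case: (boolP (e \in edges T)) => // /E ->.
Qed.

Lemma fibre_weight_delete (L : finType) T (s : V -> L) v l : v \in edges T ->
  fibre_weight T s l =
  fibre_weight (delete T v) s l + (if s v == l then weight T v else 0).
Proof.
move=> ve; rewrite /fibre_weight edges_delete /= big_mkcondr (big_setD1 v) //=.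
by rewrite addrC -big_mkcondr.
Qed.

Lemma fibre_weight0 (L : finType) T (s : V -> L) l :
  {in edges T, forall e, s e != l} -> fibre_weight T s l = 0.
Proof. by move=> H; rewrite /fibre_weight big1 // => e /andP[/H/negPf ->]. Qed.

Lemma fibre_weight_coarsen (L M : finType) (m : L -> M) T (s : V -> L) k :
  fibre_weight T (m \o s) k = \sum_(l | m l == k) fibre_weight T s l.
Proof.
rewrite /fibre_weight (partition_big s (fun l => m l == k)) => [|e /andP[]//].
apply: eq_bigr => l /eqP mk; apply: eq_bigl => e /=; rewrite -andbA; congr (_ && _).
by case: (s e =P l) => [->|]; rewrite ?mk ?eqxx ?andbF.
Qed.

End FibreWeights.

Section Alignment.
Context {R : realType} {X : editableSpaceType R} {V W : finType}.
Implicit Types (T : wtree X V) (S : wtree X W) (x y z : X).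

(** Comparability is only required of edges whose label occurs in the other tree:
    the edges of a one-sided label are deleted and may be in any position. *)
Record alignment (L : finType) T S (s : V -> L) (t : W -> L) : Prop := Alignment {
  align_chainl : forall e f g,
    e \in edges T -> f \in edges T -> g \in edges S ->
    s e = s f -> s f = t g -> le_tree T e f || le_tree T f e;
  align_chainr : forall g h e,
    g \in edges S -> h \in edges S -> e \in edges T ->
    t g = t h -> t h = s e -> le_tree S g h || le_tree S h g;
  align_order : forall e f g h,
    e \in edges T -> f \in edges T -> g \in edges S -> h \in edges S ->
    s e = t g -> s f = t h -> s e != s f ->
    le_tree T e f = le_tree S g h
}.

Definition alignment_cost (L : finType) T S (s : V -> L) (t : W -> L) : R :=
  \sum_l mdist (fibre_weight T s l) (fibre_weight S t l).

Definition alignable T S (c : R) : Prop :=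
  exists (L : finType) (s : V -> L) (t : W -> L),
    alignment T S s t /\ alignment_cost T S s t <= c.

Lemma mdist_shift x y z : mdist (x + y) z <= mdist x z + mdist y 0.
Proof. by rewrite -{1}(addr0 z); exact: mdistDD. Qed.

Lemma mdist_unshift x y z : mdist x z <= mdist (x + y) z + mdist y 0.
Proof.
rewrite addrC; apply: le_trans (metric_triangle _ (x + y) _) _; rewrite lerD2r.
by rewrite (mdistDl y 0 x) addr0 metric_sym.
Qed.

Section Labels.
Context {L : finType}.
Implicit Types (s : V -> L) (t : W -> L).

Lemma sum_mdist_single s v x :
  \sum_l mdist (if s v == l then x else 0) 0 = mdist x 0 :> R.
Proof.
rewrite (bigD1 (s v)) //= eqxx big1 ?addr0 // => l /negPf lv.
by rewrite eq_sym lv mdistxx.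
Qed.

Lemma alignment_cost_delete T S s t v : v \in edges T ->
  alignment_cost T S s t <=
  alignment_cost (delete T v) S s t + mdist (weight T v) 0.
Proof.
move=> ve; rewrite -(sum_mdist_single s v) -big_split /=; apply: ler_sum => l _.
by rewrite (fibre_weight_delete _ _ ve); exact: mdist_shift.
Qed.

Lemma alignment_cost_insert T S s t v : v \in edges T ->
  alignment_cost (delete T v) S s t <=
  alignment_cost T S s t + mdist (weight T v) 0.
Proof.
move=> ve; rewrite -(sum_mdist_single s v) -big_split /=; apply: ler_sum => l _.
by rewrite (fibre_weight_delete _ _ ve); exact: mdist_unshift.
Qed.

(** If the label of v is one-sided, it contributes a distance to 0, and such
    distances are additive: here removing v saves exactly its distance to 0. *)
Lemma alignment_cost_unmatched T S s t v : v \in edges T ->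
  {in edges S, forall g, t g != s v} ->
  alignment_cost (delete T v) S s t + mdist (weight T v) 0 =
  alignment_cost T S s t.
Proof.
move=> ve unused; rewrite -(sum_mdist_single s v) -big_split /=; apply: eq_bigr => l _.
rewrite (fibre_weight_delete _ _ ve); case: eqP => [<-|_]; last by rewrite mdistxx !addr0.
by rewrite (fibre_weight0 unused) ![mdist _ 0]metric_sym mdist0D.
Qed.

(** An edge with a one-sided label already pays for its own deletion, so by the
    triangle inequality giving it any other label costs nothing more. *)
Lemma alignment_cost_relabel T S s r t v : v \in edges T ->
  {in edges S, forall g, t g != s v} ->
  {in edges T, forall e, e != v -> r e = s e} ->
  alignment_cost T S r t <= alignment_cost T S s t.
Proof.
move=> ve unused rE; apply: le_trans (alignment_cost_delete _ _ _ ve) _.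
rewrite -(alignment_cost_unmatched ve unused) lerD2r.
rewrite le_eqVlt; apply/orP; left; apply/eqP; apply: eq_bigr => l _; congr mdist.
apply: eq_in_fibre_weight => e; rewrite edges_delete => /setD1P[ev ee].
exact: rE.
Qed.

End Labels.

Lemma alignment_cost_coarsen (L M : finType) (m : L -> M) T S s t :
  alignment_cost T S (m \o s) (m \o t) <= alignment_cost T S s t.
Proof.
rewrite [leRHS](partition_big m predT) //=; apply: ler_sum => k _.
by rewrite !fibre_weight_coarsen; exact: mdist_sum.
Qed.

End Alignment.

(** * Absorbing an edit into an alignment *)

Section Edits.
Context {R : realType} {X : editableSpaceType R}.

(** The map h may identify edges, as long as these are comparable: besides
    isomorphisms and the removal of an edge, this covers the situations where a
    vertex and its only child stand for each other. *)
Lemma alignment_pullback (V U W L : finType) (T : wtree X V) (Q : wtree X U)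
    (S : wtree X W) (h : V -> U) (s : V -> L) (r : U -> L) (t : W -> L) :
  {in edges T, forall e, h e \in edges Q} ->
  {in edges T, forall e, s e = r (h e)} ->
  {in edges T &, forall e f, h e != h f -> le_tree T e f = le_tree Q (h e) (h f)} ->
  {in edges T &, forall e f, h e = h f -> le_tree T e f || le_tree T f e} ->
  alignment Q S r t -> alignment T S s t.
Proof.
move=> hQ sE leE leN [cl cr co]; split.
- move=> e f g ee fe ge; rewrite !sE // => ef fg.
  have [/leN->//|hN] := eqVneq (h e) (h f).
  by rewrite !leE // 1?eq_sym //; apply: cl ge ef fg; exact: hQ.
- move=> g g' e gS gS' ee gg'; rewrite sE //; apply: cr => //; exact: hQ.
- move=> e f g g' ee fe gS gS'; rewrite !sE // => eg fg' ef.
  rewrite leE //; last by apply: contraNneq ef => ->.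
  by apply: co => //; exact: hQ.
Qed.

Context {V W : finType}.
Implicit Types (T : wtree X V) (S : wtree X W).

Lemma alignable_refl T : alignable T T 0.
Proof.
exists V, id, id; split; last first.
  by rewrite /alignment_cost big1 // => l _; rewrite mdistxx.
split=> [e f g _ _ _ /= ->|g h e _ _ _ /= ->|e f g h _ _ _ _ /= -> -> //].
- by rewrite le_tree_refl.
- by rewrite le_tree_refl.
Qed.

Lemma alignable_iso (U : finType) T (Q : wtree X U) S c :
  rooted T -> isomorphic T Q -> alignable Q S c -> alignable T S c.
Proof.
move=> rT [f [fI fV fr fp fw]] [L [s [t [al co]]]].
have eQ := iso_edges rT fI fV fr; have fle := iso_le rT fI fV fr fp.
have fI' : {in edges T &, injective f}.
  by move=> a b /edges_verts aT /edges_verts; exact: fI.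
exists L, (s \o f), t; split.
  apply: (alignment_pullback (h := f) _ _ _ _ al) => //.
  - by move=> e ee; rewrite eQ imset_f.
  - by move=> e g ee ge _; rewrite fle.
  - by move=> e g ee ge /fI' ->//; rewrite le_tree_refl.
apply: le_trans co; rewrite le_eqVlt; apply/orP; left; apply/eqP.
apply: eq_bigr => l _; congr mdist; rewrite /fibre_weight eQ.
rewrite [RHS]big_mkcondr big_imset //= -big_mkcondr /=.
by apply: eq_bigr => e /andP[ee _]; rewrite fw.
Qed.

Lemma alignable_shrink T S v y c : v \in edges T ->
  alignable (shrink T v y) S c -> alignable T S (mdist (weight T v) y + c).
Proof.
move=> ve [L [s [t [[cl cr co] le_c]]]]; exists L, s, t; split; first by split.
suff le_y : \sum_l mdist (fibre_weight T s l) (fibre_weight (shrink T v y) s l)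
    <= mdist (weight T v) y.
  apply: le_trans (lerD le_y le_c); rewrite -big_split /=.
  by apply: ler_sum => l _; exact: metric_triangle.
have -> : mdist (weight T v) y =
    \sum_(e in edges T) mdist (weight T e) (weight (shrink T v y) e).
  rewrite (big_setD1 v) //= eqxx big1 ?addr0 // => e /setD1P[/negPf -> _].
  by rewrite mdistxx.
by rewrite (partition_big s predT) //=; apply: ler_sum => l _; exact: mdist_sum.
Qed.

Lemma alignment_delete (L : finType) T S v (s : V -> L) (t : W -> L) :
  rooted T -> v \in edges T ->
  alignment T S s t -> alignment (delete T v) S s t.
Proof.
move=> rT ve; apply: (alignment_pullback (h := id)) => //.
- by move=> e; rewrite edges_delete => /setD1P[].
- move=> e f; rewrite edges_delete => /setD1P[ev _] /setD1P[fv _] _.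
  exact: le_delete.
- by move=> e f _ _ ->; rewrite le_tree_refl.
Qed.

Lemma alignable_delete T S v c : rooted T -> v \in edges T ->
  alignable (delete T v) S c -> alignable T S (mdist (weight T v) 0 + c).
Proof.
move=> rT ve [L [s [t [[cl cr co] le_c]]]].
(* None is a fresh label, carried by v alone. *)
pose r x := if x == v then None else Some (s x).
have rE e : e != v -> r e = Some (s e) by rewrite /r => /negPf ->.
have rP e g : r e = Some (t g) -> e != v /\ s e = t g.
  by rewrite /r; case: eqP => // _ [].
have del e : e \in edges T -> e != v -> e \in edges (delete T v).
  by move=> ee ev; rewrite edges_delete in_setD1 ev.
exists (option L : finType), r, (Some \o t); split.
  split.
  - move=> e f g ee fe gS ef /[dup] /rP[fv fg].
    rewrite -ef => /rP[ev eg]; rewrite -!(le_delete rT ve) //.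
    by apply: (cl _ _ g); rewrite ?del // eg.
  - move=> g h e gS hS ee /= [gh] /esym/rP[ev eh].
    by apply: (cr _ _ e); rewrite ?del.
  - move=> e f g h ee fe gS hS /rP[ev eg] /rP[fv fh].
    rewrite !rE // -(le_delete rT ve) // => ef.
    by apply: co; rewrite ?del //; apply: contraNneq ef => ->.
rewrite addrC; apply: le_trans (alignment_cost_delete _ _ _ ve) _; rewrite lerD2r.
apply: le_trans le_c; apply: le_trans (alignment_cost_coarsen Some _ _ _ _).
rewrite le_eqVlt; apply/orP; left; apply/eqP; apply: eq_bigr => l _; congr mdist.
by apply: eq_in_fibre_weight => e; rewrite edges_delete => /setD1P[/rE].
Qed.

Lemma alignable_insert T S v c : rooted T -> v \in edges T ->
  alignable T S c -> alignable (delete T v) S (mdist (weight T v) 0 + c).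
Proof.
move=> rT ve [L [s [t [al le_c]]]]; exists L, s, t.
split; first exact: alignment_delete.
apply: le_trans (alignment_cost_insert _ _ _ ve) _.
by rewrite addrC lerD2l.
Qed.

Lemma alignment_cost_ghost (L : finType) T S v c (s : V -> L) (t : W -> L) :
  rooted T -> v \in edges T -> children T v = [set c] -> s v = s c ->
  alignment_cost (ghost T v) S s t = alignment_cost T S s t.
Proof.
move=> rT ve cE vc; apply: eq_bigr => l _; congr mdist.
exact: fibre_weight_ghost cE vc.
Qed.

Lemma eq_in_alignment_cost (L : finType) T S (s r : V -> L) (t : W -> L) :
  {in edges T, s =1 r} -> alignment_cost T S s t = alignment_cost T S r t.
Proof.
by move=> E; apply: eq_bigr => l _; congr mdist; exact: eq_in_fibre_weight.
Qed.

Lemma only_child_edge T v c : rooted T -> children T v = [set c] ->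
  [/\ child T c v, c \in edges T & c != v].
Proof.
move=> rT cE; have cv : child T c v by rewrite (only_childP cE).
by split; [|case/childP: cv|exact: child_neq cv].
Qed.

(** The edge v takes the label of its only child c, which has absorbed the
    weight of v in the ghosted tree. *)
Lemma alignable_ghost T S v k : rooted T -> degree2 T v ->
  alignable (ghost T v) S k -> alignable T S k.
Proof.
move=> rT /degree2P[ve [c cE]] [L [s [t [al le_k]]]].
have [cv ce cNv] := only_child_edge rT cE.
pose h x := if x == v then c else x.
have hN x : x != v -> h x = x by rewrite /h => /negPf ->.
have hv : h v = c by rewrite /h eqxx.
have leg a b : a != v -> b != v -> le_tree (ghost T v) a b = le_tree T a b.
  by move=> av bv; rewrite le_ghost le_delete.
exists L, (s \o h), t; split.
  apply: (alignment_pullback (h := h) _ _ _ _ al) => //.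
  - move=> e ee; rewrite edges_ghost in_setD1.
    by have [->|ev] := eqVneq e v; rewrite ?hv ?cNv // hN ?ev.
  - move=> e f ee fe.
    have [->|ev] := eqVneq e v; have [->|fv] := eqVneq f v;
      rewrite ?hv ?hN // ?eqxx // => ef; rewrite leg //.
      by apply: le_only_child_up cE _; rewrite eq_sym.
    exact: le_only_child_down cE _.
  - move=> e f ee fe.
    have [->|ev] := eqVneq e v; have [->|fv] := eqVneq f v; rewrite ?hv ?hN //.
    + by rewrite le_tree_refl.
    + by move=> <-; rewrite (child_le cv) orbT.
    + by move=> ->; rewrite (child_le cv).
    + by move=> ->; rewrite le_tree_refl.
apply: le_trans le_k; rewrite -(alignment_cost_ghost _ _ rT ve cE); last first.
  by rewrite /= hv hN.
rewrite (@eq_in_alignment_cost _ (ghost T v) S _ s) // => e.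
by rewrite edges_ghost => /setD1P[/hN] /= ->.
Qed.

(** The labels of v and of its only child c can be merged when both occur in S,
    at gv and gc.  In T, any third such label compares in the same way with v and
    with c, and by alignment_order it compares in the same way with all edges of
    a common label; so it does not separate the two labels, neither in T nor in
    S.  As c is below v, all edges labelled like c are below all those labelled
    like v, so the merged edges form a chain. *)
Lemma alignment_merge (L : finType) T S v c (s : V -> L) (t : W -> L) gv gc :
  rooted T -> v \in edges T -> children T v = [set c] ->
  gv \in edges S -> t gv = s v -> gc \in edges S -> t gc = s c -> s v != s c ->
  let m l := if l == s v then s c else l in
  alignment T S s t -> alignment T S (m \o s) (m \o t).
Proof.
move=> rT ve cE gvS tgv gcS tgc vNc m [cl cr co].
have [cv ce cNv] := only_child_edge rT cE.
have mP x y : m x = m y -> [\/ x = y, x = s v /\ y = s c | x = s c /\ y = s v].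
  rewrite /m; case: eqP => [->|_]; case: eqP => [->|_] E.
  - by constructor 1.
  - by constructor 2.
  - by constructor 3.
  - by constructor 1.
have mvc : m (s v) = m (s c) by rewrite /m eqxx eq_sym (negPf vNc).
(* The labels that occur in S; only their edges are constrained in T. *)
pose live l := exists2 g, g \in edges S & t g = l.
have liv : live (s v) by exists gv.
have lic : live (s c) by exists gc.
have live_s e g : g \in edges S -> m (s e) = m (t g) -> live (s e).
  by move=> gS /mP[->|[-> _]|[-> _]] //; exists g.
have live_t e g : e \in edges T -> m (s e) = m (t g) ->
    exists2 e1, e1 \in edges T & s e1 = t g.
  by move=> ee /mP[<-|[_ ->]|[_ ->]]; [exists e|exists c|exists v].
(* Passing through S shows that the position of f relative to e only depends
   on the label of e. *)
have K e e1 f : e \in edges T -> e1 \in edges T -> f \in edges T ->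
    live (s e) -> live (s f) -> s e = s e1 -> s e != s f ->
    le_tree T e f = le_tree T e1 f /\ le_tree T f e = le_tree T f e1.
  move=> ee ee1 fe [g gS ge] [h hS hf] ee1E ef.
  rewrite (co e f g h) // (co e1 f g h) // -?ee1E //.
  by rewrite eq_sym in ef; rewrite (co f e h g) // (co f e1 h g) // -?ee1E.
have VC f : f \in edges T -> m (s v) != m (s f) ->
    le_tree T v f = le_tree T c f /\ le_tree T f v = le_tree T f c.
  move=> fe vf; split.
    by apply: le_only_child_up cE _; apply: contraNneq vf => ->; rewrite mvc.
  by apply: le_only_child_down cE _; apply: contraNneq vf => ->.
(* The same for merged labels: move from e to v or c inside its own label,
   exchange v and c, and move to e1 inside the label of e1. *)
have M e e1 f : e \in edges T -> e1 \in edges T -> f \in edges T ->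
    live (s e) -> live (s e1) -> live (s f) -> m (s e) = m (s e1) ->
    m (s e) != m (s f) ->
    le_tree T e f = le_tree T e1 f /\ le_tree T f e = le_tree T f e1.
  move=> ee ee1 fe le le1 lf mee1 mef.
  have sN x : m (s x) = m (s e) -> s x != s f.
    by move=> xe; apply: contraNneq mef => E; rewrite -xe E.
  case/mP: (mee1) => [E|[E E1]|[E E1]].
  - exact: K (sN _ _).
  - have [] := K e v f ee ve fe le lf E (sN _ erefl).
    have [|] := VC f fe; first by rewrite -E.
    have [] := K e1 c f ee1 ce fe le1 lf E1 (sN _ (esym mee1)).
    by move=> -> -> -> -> -> ->.
  - have [] := K e c f ee ce fe le lf E (sN _ erefl).
    have [|] := VC f fe; first by rewrite mvc -E.
    have [] := K e1 v f ee1 ve fe le1 lf E1 (sN _ (esym mee1)).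
    by move=> -> -> -> -> -> ->.
split=> /=.
- move=> e f g ee fe gS ef fg.
  have le : live (s e) by apply: (live_s _ g) => //; rewrite ef.
  have lf : live (s f) by apply: (live_s _ g).
  have low x y : x \in edges T -> y \in edges T -> live (s x) -> live (s y) ->
      s x = s v -> s y = s c -> le_tree T y x.
    move=> xe ye lx ly xv yc.
    have [_ ->] := K x v y xe ve ye lx ly xv ltac:(by rewrite xv yc).
    have [-> _] := K y c v ye ce ve ly liv yc ltac:(by rewrite yc eq_sym).
    exact: child_le.
  case/mP: ef => [ef|[ev fc]|[ec fv]].
  + by case: lf => g' gS' gf; apply: (cl _ _ g').
  + by rewrite (low e f) ?orbT.
  + by rewrite (low f e).
- move=> g h e gS hS ee gh he.
  have low x y : x \in edges S -> y \in edges S -> t x = s v -> t y = s c ->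
      le_tree S y x.
    move=> xS yS xv yc; rewrite -(co c v y x) // 1?eq_sym //; exact: child_le.
  case/mP: (gh) => [E|[gv' hc]|[gc' hv]].
  + have [e1 e1e e1E] := live_t e h ee (esym he).
    by apply: (cr _ _ e1).
  + by rewrite (low g h) ?orbT.
  + by rewrite (low h g).
- move=> e f g h ee fe gS hS eg fh ef.
  have [e1 e1e e1g] := live_t e g ee eg; have [f1 f1e f1h] := live_t f h fe fh.
  have le := live_s _ _ gS eg; have lf := live_s _ _ hS fh.
  have le1 : live (s e1) by exists g.
  have lf1 : live (s f1) by exists h.
  have me : m (s e) = m (s e1) by rewrite e1g.
  have mf : m (s f) = m (s f1) by rewrite f1h.
  have [-> _] := M e e1 f ee e1e fe le le1 lf me ef.
  have [|_ ->] := M f f1 e1 fe f1e e1e lf lf1 le1 mf; first by rewrite -me eq_sym.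
  by apply: co => //; apply: contraNneq ef => E; rewrite me mf E.
Qed.

(** The edge obtained by joining v and c keeps the name c.  It needs one label,
    chosen so that v and c had it in common before they were joined.  If the
    labels differ, they are merged when both occur in S; otherwise the edge among
    v and c with a one-sided label first takes the label of the other one, at no
    cost.  When v keeps its label, c plays the role of v in the order, whence the
    map h sending c to v. *)
Lemma alignable_split T S v k : rooted T -> degree2 T v ->
  alignable T S k -> alignable (ghost T v) S k.
Proof.
move=> rT /degree2P[ve [c cE]] [L [s [t [al le_k]]]].
have [cv ce cNv] := only_child_edge rT cE.
have alg (s' : V -> L) (t' : W -> L) : alignment T S s' t' -> alignment (ghost T v) S s' t'.
  move=> [cl cr co]; have [] := alignment_delete rT ve (Alignment cl cr co).
  by move=> cl' cr' co'; split.
have costg := alignment_cost_ghost S _ rT ve cE.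
have [vc|vNc] := eqVneq (s v) (s c).
  by exists L, s, t; split; [exact: alg | rewrite costg].
case: (boolP [exists g in edges S, t g == s v]) => [/exists_inP[gv gvS /eqP tgv]|unused].
  case: (boolP [exists g in edges S, t g == s c]) => [/exists_inP[gc gcS /eqP tgc]|unused].
    pose m l := if l == s v then s c else l.
    exists L, (m \o s), (m \o t); split.
      exact/alg/(alignment_merge rT ve cE gvS tgv gcS tgc vNc al).
    rewrite costg /=; last by rewrite /m eqxx eq_sym (negPf vNc).
    exact: le_trans (alignment_cost_coarsen _ _ _ _ _) le_k.
  have {}unused : {in edges S, forall g, t g != s c}.
    by move=> g gS; apply: contra unused => E; apply/exists_inP; exists g.
  pose h x := if x == c then v else x.
  have hN x : x != c -> h x = x by rewrite /h => /negPf ->.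
  have hc : h c = v by rewrite /h eqxx.
  exists L, (s \o h), t; split.
    apply: (alignment_pullback (h := h) _ _ _ _ al) => //.
    - move=> e; rewrite edges_ghost => /setD1P[ev ee].
      by have [->|ec] := eqVneq e c; rewrite ?hc ?hN.
    - move=> e f; rewrite edges_ghost => /setD1P[ev ee] /setD1P[fv fe].
      rewrite le_ghost le_delete //.
      have [->|ec] := eqVneq e c; have [->|fc] := eqVneq f c;
        rewrite ?hc ?hN // ?eqxx // => ef.
        by rewrite (le_only_child_up cE).
      by rewrite (le_only_child_down cE).
    - move=> e f; rewrite edges_ghost => /setD1P[ev ee] /setD1P[fv fe].
      have [->|ec] := eqVneq e c; have [->|fc] := eqVneq f c;
        rewrite ?hc ?hN // ?le_tree_refl // => E.
      + by rewrite E eqxx in fv.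
      + by rewrite E eqxx in ev.
      + by rewrite E le_tree_refl.
  rewrite costg /= ?hc ?hN //; last by rewrite eq_sym.
  apply: le_trans le_k; apply: alignment_cost_relabel ce unused _.
  by move=> e _ ec; rewrite /= hN.
have {}unused : {in edges S, forall g, t g != s v}.
  by move=> g gS; apply: contra unused => E; apply/exists_inP; exists g.
exists L, s, t; split; first exact: alg.
pose r x := if x == v then s c else s x.
have rN x : x != v -> r x = s x by rewrite /r => /negPf ->.
rewrite (@eq_in_alignment_cost _ (ghost T v) S _ r); last first.
  by move=> e; rewrite edges_ghost => /setD1P[/rN].
rewrite costg; last by rewrite [RHS]rN // /r eqxx.
apply: le_trans le_k; apply: alignment_cost_relabel ve unused _.
by move=> e _; exact: rN.
Qed.

End Edits.

(** * Reducing a labelled tree to the lowest edges of its labels *)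

Section Reduction.
Context {R : realType} {X : editableSpaceType R} {V L : finType}.
Implicit Types (T Q : wtree X V) (s : V -> L) (A : {set L}).

(** The trace on a single tree of an alignment in which A is the set of the
    labels of the other tree. *)
Record stacked T s A : Prop := Stacked {
  stacked_chain : forall e f, e \in edges T -> f \in edges T ->
    s e = s f -> s e \in A -> le_tree T e f || le_tree T f e;
  stacked_below : forall e f g,
    e \in edges T -> f \in edges T -> g \in edges T ->
    s e = s f -> s g != s e -> s e \in A -> s g \in A ->
    le_tree T g e -> le_tree T g f
}.

Lemma stacked_sub T Q s A : edges Q \subset edges T ->
  {in edges Q &, le_tree Q =2 le_tree T} -> stacked T s A -> stacked Q s A.
Proof.
move=> /fintype.subsetP sub leE [ch bl]; split=> [e f ee fe|e f g ee fe ge].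
  by rewrite !leE //; apply: ch; exact: sub.
by rewrite !leE //; apply: bl; exact: sub.
Qed.

(** Let c be the child of g on the path from b up to g.  A child x of g with
    another label than g is below b, as it is below one, hence all, of the edges
    labelled like g.  Were c such a child, it would be equal to b, whose label is
    that of g; so c has the label of g.  Any child x of g is then comparable
    with c, either because they share this label or because x is below b, and two
    comparable children of g are equal. *)
Lemma stacked_only_child T s A g b : rooted T -> stacked T s A ->
  {in edges T, forall e, s e \in A} ->
  g \in edges T -> b \in edges T -> s b = s g -> b != g -> le_tree T b g ->
  exists2 c, children T g = [set c] & s c = s g.
Proof.
move=> rT [ch bl] sA ge be bg /eqP bNg /le_tree_caser[//|[c cg bc]].
have low x : child T x g -> s x != s g -> le_tree T x b.
  move=> xg xNg; have [xe _] := childP _ _ _ xg.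
  by apply: (bl g) (child_le xg) => //; exact: sA.
have [ce _] := childP _ _ _ cg.
have scg : s c = s g.
  apply/eqP/negPn/negP => cNg; have cb := low c cg cNg.
  by move: cNg; rewrite (le_tree_anti rT cb bc) bg eqxx.
have incomp x y : child T x g -> child T y g -> le_tree T x y -> x = y.
  move=> xg yg /le_tree_case[//|[_]].
  by have [_ ->] := childP _ _ _ xg; rewrite (negPf (child_irr_le rT yg)).
exists c => //; apply/setP=> x; rewrite !inE; apply/idP/eqP => [xg|->//].
have [xe _] := childP _ _ _ xg.
have [sx|sx] := eqVneq (s x) (s g).
  have /orP[xc|cx] := ch x c xe ce ltac:(by rewrite sx scg) (sA _ xe).
    exact: incomp xc.
  by apply: esym; exact: incomp cx.
by apply: incomp => //; exact: le_tree_trans (low x xg sx) bc.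
Qed.

Lemma foldl_delete T (r : seq V) : rooted T -> uniq r ->
  {subset r <= edges T} ->
  [/\ rooted (foldl delete T r),
      edges (foldl delete T r) = edges T :\: [set x in r],
      weight (foldl delete T r) = weight T &
      {in [predC r] &, le_tree (foldl delete T r) =2 le_tree T}].
Proof.
elim: r T => [|v r IH] T rT /=.
  by split=> //; apply/setP=> x; rewrite !inE.
move=> /andP[vr ur] sub; have ve : v \in edges T by apply: sub; rewrite mem_head.
have [|rQ eQ wQ leQ] := IH (delete T v) (rooted_delete rT ve) ur.
  move=> x xr; rewrite edges_delete in_setD1 sub ?inE ?xr ?orbT // andbT.
  by apply: contraNneq vr => <-.
split=> //.
  rewrite eQ edges_delete; apply/setP=> x; rewrite !finset.in_setD !inE negb_or.
  by rewrite andbCA andbA.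
move=> a b; rewrite !inE !negb_or => /andP[av ar] /andP[bv br].
by rewrite leQ ?inE // le_delete.
Qed.

(** Each edge of r keeps, during the whole process, an edge b below it with the
    same label, so stacked_only_child applies at each step; the total weights are
    preserved because the only child has the label of the ghosted edge. *)
Lemma foldl_ghost T s A (r : seq V) : rooted T -> stacked T s A ->
  {in edges T, forall e, s e \in A} -> uniq r -> {subset r <= edges T} ->
  {in r, forall g, exists b,
    [/\ b \in edges T, b \notin r, s b = s g & le_tree T b g]} ->
  edges (foldl ghost T r) = edges T :\: [set x in r] /\
  forall l, fibre_weight (foldl ghost T r) s l = fibre_weight T s l.
Proof.
elim: r T => [|g r IH] T rT st sA /=.
  by split=> //; apply/setP=> x; rewrite !inE.
move=> /andP[gr ur] sub low; have ge : g \in edges T by apply: sub; rewrite mem_head.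
have [b [be bNr bg leb]] := low g (mem_head _ _).
have bNg : b != g by apply: contraNneq bNr => ->; rewrite mem_head.
have [c cE cg] := stacked_only_child rT st sA ge be bg bNg leb.
have leE : {in edges (ghost T g) &, le_tree (ghost T g) =2 le_tree T}.
  move=> x y; rewrite edges_ghost => /setD1P[xg _] /setD1P[yg _].
  by rewrite le_ghost le_delete.
have subE : edges (ghost T g) \subset edges T by rewrite edges_ghost finset.subD1set.
have rE x : x \in r -> x \in edges (ghost T g).
  move=> xr; rewrite edges_ghost in_setD1 sub ?inE ?xr ?orbT // andbT.
  by apply: contraNneq gr => <-.
have sAE : {in edges (ghost T g), forall e, s e \in A}.
  by move=> e /(fintype.subsetP subE); exact: sA.
have [//|x xr|eQ wQ] := IH (ghost T g) (rooted_ghost rT ge) (stacked_sub subE leE st) sAE ur.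
  have [|d [de]] := low x; first by rewrite inE xr orbT.
  rewrite inE negb_or => /andP[dg dr] dx led.
  have dE : d \in edges (ghost T g) by rewrite edges_ghost in_setD1 dg.
  by exists d; split=> //; rewrite leE // rE.
split=> [|l].
  rewrite eQ edges_ghost; apply/setP=> x; rewrite !finset.in_setD !inE negb_or.
  by rewrite andbCA andbA.
by rewrite wQ (fibre_weight_ghost _ rT ge cE).
Qed.

End Reduction.

(** * Deleted, ghosted and coupled edges of an alignment *)

Section Sides.
Context {R : realType} {X : editableSpaceType R} {V W L : finType}.
Implicit Types (T : wtree X V) (S : wtree X W) (s : V -> L) (t : W -> L).

Lemma alignment_sym T S s t : alignment T S s t -> alignment S T t s.
Proof.
move=> [cl cr co]; split=> // g h e f gS hS ee fe ge hf gh.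
by apply/esym; apply: co => //; rewrite -ge -hf.
Qed.

Lemma alignment_stacked T S s t :
  alignment T S s t -> stacked T s (t @: edges S).
Proof.
move=> [cl cr co]; split=> [e f ee fe ef|e f g ee fe ge ef gNe].
  by rewrite ef => /imsetP[h hS fh]; apply: (cl _ _ h).
move=> /imsetP[h hS eh] /imsetP[k kS gk].
rewrite (co g e k h) // -(co g f k h) //; first by rewrite -ef.
by rewrite -ef.
Qed.

Definition unmatched T s S t : {set V} :=
  [set e in edges T | s e \notin t @: edges S].

Definition bottoms T s S t : {set V} :=
  [set e in edges T | (s e \in t @: edges S) &&
    [forall f in edges T, (s f == s e) ==> le_tree T e f]].

Definition uppers T s S t : {set V} :=
  edges T :\: (unmatched T s S t :|: bottoms T s S t).

Lemma bottomsP T s S t e :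
  reflect [/\ e \in edges T, s e \in t @: edges S &
              {in edges T, forall f, s f = s e -> le_tree T e f}]
          (e \in bottoms T s S t).
Proof.
rewrite [e \in bottoms _ _ _ _]inE; apply: (iffP and3P) => -[-> ->] H; split=> //.
  by move=> f fe /eqP fE; move/forall_inP: H => /(_ f fe)/implyP; exact.
by apply/forall_inP => f fe; apply/implyP => /eqP; exact: H.
Qed.

Lemma bottoms_inj T s S t : rooted T ->
  {in bottoms T s S t &, injective s}.
Proof.
move=> rT a b /bottomsP[ae _ aB] /bottomsP[be _ bB] ab.
by apply: (le_tree_anti rT); [exact: aB | exact: bB].
Qed.

(** The edges labelled like e form a chain; its lowest element is found as the
    one with the fewest elements of the chain below it. *)
Lemma bottom_exists T S s t e : rooted T -> alignment T S s t ->
  e \in edges T -> s e \in t @: edges S ->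
  exists2 b, b \in bottoms T s S t & s b = s e.
Proof.
move=> rT /alignment_stacked[ch _] ee se.
pose F := [set f in edges T | s f == s e].
have eF : e \in F by rewrite inE ee eqxx.
pose down f := [set x in F | le_tree T x f].
have [b bF bmin] := arg_minnP (fun f => #|down f|) eF.
have /setIdP[be /eqP bE] : b \in F by [].
exists b => //; apply/bottomsP; split; rewrite ?bE // => f fe fE.
have fF : f \in F by rewrite inE fe fE eqxx.
have /orP[//|fb] := ch b f be fe ltac:(by rewrite bE fE) ltac:(by rewrite bE).
have := bmin f fF; rewrite leqNgt => /negP bf; apply/negPn/negP => nbf; case: bf.
apply: proper_card; apply/fintype.properP; split.
  apply/fintype.subsetP=> x; rewrite !inE => /andP[-> xf] /=; exact: le_tree_trans xf fb.
exists b; first by apply/setIdP; rewrite le_tree_refl.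
by apply/negP => /setIdP[_ bf]; rewrite bf in nbf.
Qed.

Lemma unmatched_sub T s S t : unmatched T s S t \subset edges T.
Proof. by apply/fintype.subsetP=> e; rewrite inE => /andP[]. Qed.

(** The last item provides the lower edge with the same label that
    stacked_only_child and foldl_ghost require. *)
Lemma matched_tree T S s t : rooted T -> alignment T S s t ->
  let Q := delete_all T (unmatched T s S t) in
  [/\ rooted Q, edges Q = edges T :\: unmatched T s S t, weight Q = weight T,
      stacked Q s (t @: edges S) &
      {in uppers T s S t, forall g, exists b,
        [/\ b \in bottoms T s S t, b \in edges Q, s b = s g, b != g & le_tree Q b g]}].
Proof.
move=> rT al Q.
have [|rQ eQ wQ leQ] := @foldl_delete _ _ _ T (enum (unmatched T s S t)) rT (enum_uniq _).
  by move=> x; rewrite mem_enum; apply/fintype.subsetP; exact: unmatched_sub.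
rewrite -/(delete_all _ _) -/Q in rQ eQ wQ leQ.
have uE : [set x in enum (unmatched T s S t)] = unmatched T s S t.
  by apply/setP=> x; rewrite inE mem_enum.
rewrite uE in eQ.
have leQ' : {in edges Q &, le_tree Q =2 le_tree T}.
  move=> x y; rewrite eQ => /finset.setDP[_ xu] /finset.setDP[_ yu].
  by apply: leQ; rewrite inE mem_enum.
split=> //.
  apply: stacked_sub (alignment_stacked al) => //.
  by rewrite eQ finset.subsetDl.
move=> g /finset.setDP[ge]; rewrite finset.in_setU negb_or => /andP[gu gb].
have gm : s g \in t @: edges S by move: gu; rewrite inE ge negbK.
have [b bb bg] := bottom_exists rT al ge gm.
have [be bm bmin] := bottomsP _ _ _ _ _ bb.
have beQ : b \in edges Q by rewrite eQ finset.in_setD be andbT inE be bm.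
have geQ : g \in edges Q by rewrite eQ finset.in_setD ge gu.
exists b; split=> //; first by apply: contraNneq gb => <-.
by rewrite leQ' // bmin.
Qed.

Lemma upper_degree2 T S s t g : rooted T -> alignment T S s t ->
  g \in uppers T s S t -> degree2 (delete_all T (unmatched T s S t)) g.
Proof.
move=> rT al gU; have [rQ eQ _ stQ low] := matched_tree rT al.
have [b [_ be bg bNg leb]] := low g gU.
have sA : {in edges (delete_all T (unmatched T s S t)), forall e, s e \in t @: edges S}.
  by move=> e; rewrite eQ => /finset.setDP[ee]; rewrite inE ee negbK.
have ge : g \in edges (delete_all T (unmatched T s S t)).
  move: gU; rewrite eQ => /finset.setDP[ge]; rewrite finset.in_setU negb_or => /andP[gu _].
  by rewrite finset.in_setD gu.
have [c cE _] := stacked_only_child rQ stQ sA ge be bg bNg leb.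
by apply/degree2P; split=> //; exists c.
Qed.

(** After all ghostings b is the only edge left with its label, so it carries the
    whole weight of this label. *)
Lemma reduced_weight T S s t b : rooted T -> alignment T S s t ->
  b \in bottoms T s S t ->
  weight (ghost_all (delete_all T (unmatched T s S t)) (uppers T s S t)) b =
  fibre_weight T s (s b).
Proof.
move=> rT al bB; have [rQ eQ wQ stQ low] := matched_tree rT al.
set Q := delete_all _ _ in rQ eQ wQ stQ low *.
have sA : {in edges Q, forall e, s e \in t @: edges S}.
  by move=> e; rewrite eQ => /finset.setDP[ee]; rewrite inE ee negbK.
have [x|x|eG wG] := foldl_ghost (r := enum (uppers T s S t)) rQ stQ sA (enum_uniq _).
- rewrite mem_enum eQ => /finset.setDP[xe]; rewrite finset.in_setU negb_or.
  by move=> /andP[xu _]; rewrite finset.in_setD xu.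
- rewrite mem_enum => /low[a [aB ae ax _ leax]]; exists a; split=> //.
  by rewrite mem_enum finset.in_setD finset.in_setU aB orbT.
rewrite -/(ghost_all _ _) in eG wG.
have [be bm bmin] := bottomsP _ _ _ _ _ bB.
have wE : fibre_weight Q s (s b) = fibre_weight T s (s b).
  rewrite /fibre_weight wQ; apply: eq_bigl => e; rewrite eQ finset.in_setD.
  case: (s e =P s b) => [sE|]; rewrite ?andbF // !andbT inE sE bm /= andbF.
  by [].
rewrite -wE -wG /fibre_weight (big_pred1 b) // => e.
rewrite eG eQ /=; apply/andP/eqP => [[/finset.setDP[/finset.setDP[ee eu]]]|->].
  rewrite inE mem_enum finset.in_setD ee andbT negbK finset.in_setU (negPf eu) /= => eB /eqP.
  exact: (bottoms_inj rT eB bB).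
split=> //; apply/finset.setDP; split.
  by apply/finset.setDP; split=> //; apply/negP => /setIdP[_]; rewrite bm.
by rewrite inE mem_enum finset.in_setD finset.in_setU bB orbT.
Qed.

(** Distances to 0 are additive, and S gives weight 0 to the labels that it does
    not use. *)
Lemma unmatched_cost T S s t :
  \sum_(v in unmatched T s S t) mdist (weight T v) 0 =
  \sum_(l | l \notin t @: edges S) mdist (fibre_weight T s l) (fibre_weight S t l).
Proof.
rewrite (partition_big s (fun l => l \notin t @: edges S)) /=; last first.
  by move=> v; rewrite inE => /andP[].
apply: eq_bigr => l ml; rewrite [fibre_weight S t l]fibre_weight0; last first.
  by move=> g gS; apply: contraNneq ml => <-; rewrite imset_f.
rewrite metric_sym mdist0_sum; apply: eq_big => [v|v _]; last exact: metric_sym.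
by rewrite inE; case: eqP => [->|]; rewrite ?andbF // ml !andbT.
Qed.

End Sides.

(** * The mapping defined by an alignment *)

Section MappingOfLabels.
Context {R : realType} {X : editableSpaceType R} {V W L : finType}.
Implicit Types (T : wtree X V) (S : wtree X W) (s : V -> L) (t : W -> L).

Definition mapping_of_labels T S s t : pairing V W :=
  [set p | match p with
           | (inl v, inl w) =>
             [&& v \in bottoms T s S t, w \in bottoms S t T s & s v == t w]
           | (inl v, inr Deletion) => v \in unmatched T s S t
           | (inl v, inr Ghosting) => v \in uppers T s S t
           | (inr Deletion, inl w) => w \in unmatched S t T s
           | (inr Ghosting, inl w) => w \in uppers S t T s
           | (inr _, inr _) => false
           end].

Lemma couplesP T S s t v w :
  reflect [/\ v \in bottoms T s S t, w \in bottoms S t T s & s v = t w]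
          ((inl v, inl w) \in mapping_of_labels T S s t).
Proof. by rewrite [X in reflect _ X]inE; apply: (iffP and3P) => -[-> -> /eqP]. Qed.

Lemma deletedl_labels T S s t :
  deletedl (mapping_of_labels T S s t) = unmatched T s S t.
Proof. by apply/setP=> v; rewrite [LHS]finset.in_set [LHS]finset.in_set. Qed.

Lemma deletedr_labels T S s t :
  deletedr (mapping_of_labels T S s t) = unmatched S t T s.
Proof. by apply/setP=> v; rewrite [LHS]finset.in_set [LHS]finset.in_set. Qed.

Lemma ghostedl_labels T S s t :
  ghostedl (mapping_of_labels T S s t) = uppers T s S t.
Proof. by apply/setP=> v; rewrite [LHS]finset.in_set [LHS]finset.in_set. Qed.

Lemma ghostedr_labels T S s t :
  ghostedr (mapping_of_labels T S s t) = uppers S t T s.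
Proof. by apply/setP=> v; rewrite [LHS]finset.in_set [LHS]finset.in_set. Qed.

Lemma bottom_partner T S s t v :
  rooted S -> alignment T S s t -> v \in bottoms T s S t ->
  exists2 w, w \in bottoms S t T s & s v = t w.
Proof.
move=> rS /alignment_sym al' /bottomsP[ve /imsetP[g gS vg] _].
have [|w wB wg] := bottom_exists rS al' gS; first by rewrite -vg imset_f.
by exists w; rewrite ?wg.
Qed.

Lemma couple_order T S s t a b c d :
  rooted T -> rooted S -> alignment T S s t ->
  (inl a, inl b) \in mapping_of_labels T S s t ->
  (inl c, inl d) \in mapping_of_labels T S s t ->
  below T c a = below S d b.
Proof.
move=> rT rS al /couplesP[aB bB ab] /couplesP[cB dB cd]; rewrite !belowE.
have [ca|ca] := eqVneq (s c) (s a).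
  have -> : c = a by exact: (bottoms_inj rT cB aB ca).
  have -> : d = b by apply: (bottoms_inj rS dB bB); rewrite -cd -ab.
  by rewrite !eqxx.
have -> : c != a by apply: contraNneq ca => ->.
have -> : d != b by apply: contraNneq ca => E; rewrite cd E ab.
have [ae _ _] := bottomsP _ _ _ _ _ aB; have [be _ _] := bottomsP _ _ _ _ _ bB.
have [ce _ _] := bottomsP _ _ _ _ _ cB; have [de _ _] := bottomsP _ _ _ _ _ dB.
by rewrite (align_order al ce ae de be cd ab ca).
Qed.

Lemma mapping_of_labels_uniq T S s t v :
  rooted S -> alignment T S s t -> v \in edges T ->
  exists! q, (inl v, q) \in mapping_of_labels T S s t.
Proof.
move=> rS al ve.
case: (boolP (v \in unmatched T s S t)) => vu.
  exists (inr Deletion); split=> [|[w|[]]]; rewrite finset.in_set //.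
    move=> /and3P[/bottomsP[_ vm]]; move: vu.
    by rewrite finset.in_set vm andbF.
  by move=> /finset.setDP[_]; rewrite finset.in_setU vu.
case: (boolP (v \in bottoms T s S t)) => vb.
  have [w wB vw] := bottom_partner rS al vb.
  exists (inl w); split=> [|[w'|[]]]; first exact/couplesP.
  - move=> /couplesP[_ wB' vw']; congr inl.
    by apply: (bottoms_inj rS wB wB'); rewrite -vw -vw'.
  - by rewrite finset.in_set (negPf vu).
  - by rewrite finset.in_set => /finset.setDP[_]; rewrite finset.in_setU vb orbT.
exists (inr Ghosting); split=> [|[w|[]]]; rewrite finset.in_set ?(negPf vu) ?(negPf vb) //.
by apply/finset.setDP; rewrite finset.in_setU negb_or vu.
Qed.

Lemma mapping_of_labels_edge T S s t v q :
  (inl v, q) \in mapping_of_labels T S s t -> v \in edges T.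
Proof.
rewrite finset.in_set; case: q => [w|[]].
- by case/and3P => /bottomsP[].
- by case/setIdP.
- by case/finset.setDP.
Qed.

End MappingOfLabels.

Section Realization.
Context {R : realType} {X : editableSpaceType R} {V W L : finType}.
Context (T : wtree X V) (S : wtree X W) (s : V -> L) (t : W -> L).
Context (rT : rooted T) (rS : rooted S) (al : alignment T S s t).

Let M := mapping_of_labels T S s t.

(** Exchanging the two trees turns each fact about T into the one about S. *)
Lemma mapping_of_labels_sym p q :
  ((p, q) \in M) = ((q, p) \in mapping_of_labels S T t s).
Proof.
rewrite !finset.in_set; case: p q => [v|[]] [w|[]] //.
by rewrite andbCA eq_sym andbA [X in X && _]andbC -andbA andbCA.
Qed.

Lemma mapping_of_labelsP : is_mapping T S M.
Proof.
have al' := alignment_sym al; split.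
- case=> -[v|a] [w|b] /= pM; rewrite ?andbT.
  + rewrite (mapping_of_labels_edge pM).
    by move: pM; rewrite mapping_of_labels_sym => /mapping_of_labels_edge.
  + exact: mapping_of_labels_edge pM.
  + by move: pM; rewrite mapping_of_labels_sym => /mapping_of_labels_edge.
  + by [].
- by case=> -[]; rewrite finset.in_set.
- move=> v /(mapping_of_labels_uniq rS al)[q [vq uq]]; exists (inl v, q).
  by split=> // -[x y] [xM /= xE]; rewrite xE in xM *; rewrite (uq _ xM).
- move=> w /(mapping_of_labels_uniq rT al')[q [wq uq]]; exists (q, inl w).
  split=> [|[x y] [xM /= yE]]; first by rewrite mapping_of_labels_sym.
  by rewrite yE in xM *; rewrite mapping_of_labels_sym in xM; rewrite (uq _ xM).
- by move=> a b c d ab cd; rewrite (couple_order rT rS al ab cd).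
- move=> a; rewrite finset.in_set deletedl_labels; exact: upper_degree2.
- move=> b; rewrite finset.in_set deletedr_labels; exact: upper_degree2.
Qed.

Lemma couples_cost :
  \sum_(vw : V * W | (inl vw.1, inl vw.2) \in M)
     mdist (weight (reducedl T M) vw.1) (weight (reducedr S M) vw.2) =
  \sum_(l | (l \in s @: edges T) && (l \in t @: edges S))
     mdist (fibre_weight T s l) (fibre_weight S t l).
Proof.
have al' := alignment_sym al.
rewrite (partition_big (fun vw => s vw.1)
  (fun l => (l \in s @: edges T) && (l \in t @: edges S))) /=; last first.
  by move=> [v w] /couplesP[/bottomsP[ve vm _] _ _] /=; rewrite vm imset_f.
apply: eq_bigr => l /andP[/imsetP[e ee lE] lS].
rewrite {}lE in lS *; have [v vB ve] := bottom_exists rT al ee lS.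
have [w wB vw] := bottom_partner rS al vB.
rewrite (big_pred1 (v, w)) => [|[a b] /=].
  rewrite /reducedl /reducedr deletedl_labels deletedr_labels.
  rewrite ghostedl_labels ghostedr_labels /=.
  by rewrite (reduced_weight rT al vB) (reduced_weight rS al' wB) -vw ve.
apply/andP/eqP => [[/couplesP[aB bB ab] /eqP ae]|[-> ->]].
  congr pair; first by apply: (bottoms_inj rT aB vB); rewrite ae ve.
  by apply: (bottoms_inj rS bB wB); rewrite -ab -vw ae ve.
by split; [exact/couplesP | rewrite ve].
Qed.

Lemma mapping_of_labels_cost : mapping_cost T S M = alignment_cost T S s t.
Proof.
rewrite /mapping_cost couples_cost deletedl_labels deletedr_labels !unmatched_cost.
pose d l := mdist (fibre_weight T s l) (fibre_weight S t l).
rewrite /alignment_cost -!/(d _).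
rewrite [X in _ + X + _](eq_bigr d) => [|l _]; last exact: metric_sym.
rewrite [X in X + _ + _]big_mkcond [X in _ + X + _]big_mkcond.
rewrite [X in _ + _ + X]big_mkcond -!big_split /=; apply: eq_bigr => l _.
have out (Y Z : finType) (Q : wtree X Y) (r : Y -> Z) k :
    k \notin r @: edges Q -> fibre_weight Q r k = 0.
  by move=> kN; apply: fibre_weight0 => e ee; apply: contraNneq kN => <-; rewrite imset_f.
case: (boolP (l \in s @: edges T)) => lT; case: (boolP (l \in t @: edges S)) => lS /=;
  rewrite ?addr0 ?add0r //.
by rewrite /d !out // mdistxx addr0.
Qed.

End Realization.

(** * From edit paths to mappings *)

Lemma edit_path_alignable (R : realType) (X : editableSpaceType R)
    (T T' : dendrogram X) (gamma : edit_path T T') :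
  alignable T T' (path_cost gamma).
Proof.
have rd (Q : dendrogram X) : rooted Q := dendrogram_rooted (dendrogramP Q).
elim: gamma => {T T'} [T T' iso|T T1 T' e gamma IH] /=.
  exact: alignable_iso iso (alignable_refl _).
case: e => [v y ve _ iso|v ve iso|v ve iso|v dv iso|v dv iso] /=.
- by apply: alignable_shrink ve _; exact: (alignable_iso (rd T : rooted (shrink T v y)) iso).
- apply: alignable_delete => //; apply: alignable_iso iso IH.
  exact: rooted_delete.
- have iso' := isomorphic_sym (rooted_delete (rd _) ve) iso.
  by apply: alignable_iso iso' _ => //; exact: alignable_insert.
- rewrite add0r; have [ve _] := degree2P _ _ dv.
  apply: alignable_ghost dv _ => //; apply: alignable_iso iso IH.
  exact: rooted_ghost.
- rewrite add0r; have [ve _] := degree2P _ _ dv.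
  have iso' := isomorphic_sym (rooted_ghost (rd _) ve) iso.
  by apply: alignable_iso iso' _ => //; exact: alignable_split.
Qed.

Theorem theorem2 (R : realType) (X : editableSpaceType R)
    (T T' : dendrogram X) (gamma : edit_path T T') :
  exists2 M : pairing (vtype T) (vtype T'),
    is_mapping T T' M & mapping_cost T T' M <= path_cost gamma.
Proof.
have [L [s [t [al le_gamma]]]] := edit_path_alignable gamma.
have rd (Q : dendrogram X) : rooted Q := dendrogram_rooted (dendrogramP Q).
exists (mapping_of_labels T T' s t); first exact: mapping_of_labelsP.
by rewrite mapping_of_labels_cost.
Qed.
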